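(* Let $(F,\|\cdot\|)$ be a proper positively polarizable hyperbolically normed cone (over $\mathbb{R}$) satisfying the following conditions: (i) (Finiteness) $\|v\|<+\infty$ for all $v\in F$. (ii) (Non-triviality) There exists $t\in F$ such that $\|t\|>0$. (iii) (Strict hyperbolicity) Whenever $\|u+v\|=\|u\|+\|v\|$ for $u,v\in F$, then $u$ and $v$ are linearly dependent in $F$, i.e., $u=\lambda v$ or $v=\lambda u$ for some $\lambda\ge0$. Then the inner product $\langle\cdot,\cdot\rangle$ on $\mathrm{span}(F)$ induced by $\|\cdot\|$ is nondegenerate, i.e., if $v\in\mathrm{span}(F)$ satisfies $\langle v,u\rangle=0$ for all $u\in\mathrm{span}(F)$, then $v=0$.
   Context: A linear cone over $\mathbb{R}$ is a commutative, cancellative monoid $(F,+)$ with a scalar multiplication $[0,\infty)\times F\to F$ such that $\lambda(v+w)=\lambda v+\lambda w$, $(\lambda+\mu)v=\lambda v+\mu v$, $\lambda(\mu v)=(\lambda\mu)v$, $1v=v$. It is proper if no $v\in F\setminus\{0\}$ has an additive inverse in $F$. $\mathrm{span}(F)=(F\times F)/\sim$, with $(v_1,w_1)\sim(v_2,w_2)$ iff $v_1+w_2=v_2+w_1$, is a real vector space into which $F$ embeds via $v\mapsto[(v,0)]$; $F$ is identified with its image, and every element of $\mathrm{span}(F)$ has the form $v-w$ with $v,w\in F$. A hyperbolic norm on $F$ is a map $\|\cdot\|:F\to[0,\infty]$ with $\|v+w\|\ge\|v\|+\|w\|$ and $\|\lambda v\|=\lambda\|v\|$ for all $v,w\in F$,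 $\lambda\ge0$ (convention $0\cdot\infty=0$); $(F,\|\cdot\|)$ is then a hyperbolically normed cone. It is positively polarizable if $\|v+2w\|^2+\|v\|^2=2\|v+w\|^2+2\|w\|^2$ for all $v,w\in F$. An inner product is a symmetric bilinear form. For a finite-valued positively polarizable hyperbolic norm, $\langle v,w\rangle:=\frac12(\|v+w\|^2-\|v\|^2-\|w\|^2)$, $v,w\in F$, is symmetric and nonnegatively bilinear on $F$ and extends uniquely to a symmetric bilinear form on $\mathrm{span}(F)$, called the induced inner product. *)

(* Defs.v *)
From HB Require Import structures.
From mathcomp Require Import all_boot all_order all_algebra.
From mathcomp Require Import boolp reals constructive_ereal interval_inference.
From mathcomp Require Import ring lra.

Set Implicit Arguments.
Unset Strict Implicit.
Unset Printing Implicit Defensive.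

Import Order.TTheory GRing.Theory Num.Theory.
Local Open Scope ring_scope.
Local Open Scope quotient_scope.

Reserved Notation "l *^ v" (at level 40, left associativity).

(* No axiom 0 *^ v = 0 is needed: it follows from cancellativity. Since
   classical logic is used throughout, the eqType and choiceType structures of
   the underlying nmodType are no restriction. *)
HB.mixin Record Nmodule_isLinearCone (R : realType) F of GRing.Nmodule F := {
  cone_scale : {nonneg R} -> F -> F;
  cone_addrI : right_injective (+%R : F -> F -> F);
  cone_scaleDr : forall l v w,
    cone_scale l (v + w) = cone_scale l v + cone_scale l w;
  cone_scaleDl : forall l m v,
    cone_scale (l%:num + m%:num)%:nng v = cone_scale l v + cone_scale m v;
  cone_scaleA : forall l m v,
    cone_scale l (cone_scale m v) = cone_scale (l%:num * m%:num)%:nng v;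
  cone_scale1 : forall v, cone_scale 1%:nng v = v
}.

#[short(type="linearConeType")]
HB.structure Definition LinearCone (R : realType) :=
  {F of Nmodule_isLinearCone R F & GRing.Nmodule F}.

Notation "l *^ v" := (cone_scale l v) : ring_scope.

Section ConeNorm.
Variables (R : realType) (F : linearConeType R).
Implicit Types (u v w : F) (l m : {nonneg R}) (N : F -> \bar R).

Definition proper_cone := forall v w, v + w = 0 -> v = 0.

(* In \bar R one has 0 * +oo = 0. *)
Definition hyperbolic_norm N :=
  [/\ forall v, (0 <= N v)%E,
      forall v w, (N v + N w <= N (v + w)%R)%E &
      forall l v, N (l *^ v) = (l%:num%:E * N v)%E].

Definition positively_polarizable N := forall v w,
  (N (v + 2%:nng *^ w)%R ^+ 2 + N v ^+ 2 =
   2%:E * N (v + w)%R ^+ 2 + 2%:E * N w ^+ 2)%E.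

Definition strictly_hyperbolic N := forall u v,
  N (u + v) = (N u + N v)%E -> exists l, u = l *^ v \/ v = l *^ u.

(* Meaningful for finite-valued N only, because of fine. *)
Definition cone_inner N v w : R :=
  2^-1 * (fine (N (v + w)) ^+ 2 - fine (N v) ^+ 2 - fine (N w) ^+ 2).

Lemma cone_scale0 v : 0%:nng *^ v = 0 :> F.
Proof.
apply: (@cone_addrI R F (0%:nng *^ v)); rewrite addr0 -cone_scaleDl.
by congr (_ *^ _); apply/val_inj; rewrite /= addr0.
Qed.

Lemma cone_scaler0 l : l *^ (0 : F) = 0.
Proof.
by apply: (@cone_addrI R F (l *^ 0)); rewrite addr0 -cone_scaleDr addr0.
Qed.

Lemma cone_addIr : left_injective (+%R : F -> F -> F).
Proof. by move=> a b c; rewrite ![_ + a]addrC; apply: (@cone_addrI R F). Qed.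

End ConeNorm.

Section Span.
Variables (R : realType) (F : linearConeType R).
Implicit Types (u v w : F) (p q : F * F).

Definition span_rel p q := p.1 + q.2 == q.1 + p.2.

Lemma span_rel_refl : reflexive span_rel.
Proof. by move=> p; rewrite /span_rel. Qed.

Lemma span_rel_sym : symmetric span_rel.
Proof. by move=> p q; rewrite /span_rel eq_sym. Qed.

Lemma span_rel_trans : transitive span_rel.
Proof.
move=> q p r /eqP pq /eqP qr; apply/eqP/(@cone_addIr R F q.2).
by rewrite /= addrAC pq addrAC qr addrAC.
Qed.

Canonical span_equiv := EquivRel span_rel span_rel_refl span_rel_sym
  span_rel_trans.

Definition cone_span := {eq_quot span_rel}.

HB.instance Definition _ := Choice.on cone_span.
HB.instance Definition _ := EqQuotient.on cone_span.

Definition span_pi p : cone_span := \pi_cone_span p.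

Definition span_add (x y : cone_span) : cone_span :=
  span_pi ((repr x).1 + (repr y).1, (repr x).2 + (repr y).2).
Definition span_opp (x : cone_span) : cone_span :=
  span_pi ((repr x).2, (repr x).1).

(* l [(v, w)] = [(l^+ v + l^- w, l^+ w + l^- v)], where l = l^+ - l^-. *)
Definition pair_scale (a b : {nonneg R}) p : F * F :=
  (a *^ p.1 + b *^ p.2, a *^ p.2 + b *^ p.1).
Fact pos_part_subproof (l : R) : 0 <= Num.max 0 l.
Proof. by rewrite le_max lexx. Qed.
Definition pos_part (l : R) : {nonneg R} := NngNum (pos_part_subproof l).
Definition span_scale (l : R) (x : cone_span) : cone_span :=
  span_pi (pair_scale (pos_part l) (pos_part (- l)) (repr x)).

Definition span_embed v : cone_span := span_pi (v, 0).

Lemma spanW (P : cone_span -> Prop) :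
  (forall p, P (span_pi p)) -> forall x, P x.
Proof. by move=> h x; rewrite -[x]reprK. Qed.

Lemma span_pi_eq p q : p.1 + q.2 = q.1 + p.2 -> span_pi p = span_pi q.
Proof. by move=> h; apply/eqP; rewrite eqmodE; apply/eqP. Qed.

Lemma span_reprP p :
  (repr (span_pi p)).1 + p.2 = p.1 + (repr (span_pi p)).2.
Proof.
by apply/eqP; rewrite -[_ == _]/(span_rel _ p) -eqmodE reprK.
Qed.

Lemma span_addE p q : span_add (span_pi p) (span_pi q) =
  span_pi (p.1 + q.1, p.2 + q.2).
Proof.
by apply: span_pi_eq => /=; rewrite addrACA !span_reprP addrACA.
Qed.

Lemma span_oppE p : span_opp (span_pi p) = span_pi (p.2, p.1).
Proof. by apply: span_pi_eq => /=; rewrite addrC -span_reprP addrC. Qed.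

Lemma pair_scale_pi (a b c d : {nonneg R}) p q :
    a%:num + d%:num = c%:num + b%:num -> p.1 + q.2 = q.1 + p.2 ->
  span_pi (pair_scale a b p) = span_pi (pair_scale c d q).
Proof.
move=> ad pq; transitivity (span_pi (pair_scale a b q)).
  apply: span_pi_eq => /=; rewrite addrACA [RHS]addrACA -!cone_scaleDr pq.
  by congr (_ + _ *^ _); rewrite addrC -pq addrC.
have E (w : F) : a *^ w + d *^ w = c *^ w + b *^ w.
  by rewrite -!cone_scaleDl; congr (_ *^ _); apply/val_inj.
apply: span_pi_eq => /=.
rewrite [c *^ q.2 + _]addrC [a *^ q.2 + _]addrC addrACA [RHS]addrACA E.
by congr (_ + _); rewrite addrC -E addrC.
Qed.

Lemma pos_partE (l : R) : l = (pos_part l)%:num - (pos_part (- l))%:num.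
Proof. by rewrite /= !maxEle; do 2 case: ifP; lra. Qed.

Lemma span_scaleE l (a b : {nonneg R}) p : l = a%:num - b%:num ->
  span_scale l (span_pi p) = span_pi (pair_scale a b p).
Proof.
move=> lab; apply: pair_scale_pi; last exact: span_reprP.
have := pos_partE l; rewrite {1}lab; lra.
Qed.

Lemma span_addA : associative (@span_add).
Proof.
elim/spanW=> p; elim/spanW=> q; elim/spanW=> r.
by rewrite !span_addE /= !addrA.
Qed.

Lemma span_addC : commutative (@span_add).
Proof.
elim/spanW=> p; elim/spanW=> q.
by rewrite !span_addE [p.1 + _]addrC [p.2 + _]addrC.
Qed.

Lemma span_add0 : left_id (span_pi (0, 0)) span_add.
Proof. by elim/spanW=> -[p1 p2]; rewrite !span_addE /= !add0r. Qed.

Lemma span_addN : left_inverse (span_pi (0, 0)) span_opp span_add.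
Proof.
elim/spanW=> p; rewrite span_oppE span_addE; apply: span_pi_eq.
by rewrite /= addr0 add0r addrC.
Qed.

HB.instance Definition _ := GRing.isZmodule.Build cone_span
  span_addA span_addC span_add0 span_addN.

Lemma span_scaleA a b x : span_scale a (span_scale b x) = span_scale (a * b) x.
Proof.
elim/spanW: x => p.
rewrite (span_scaleE _ (pos_partE b)) (span_scaleE _ (pos_partE a)).
set a1 := pos_part a; set a2 := pos_part (- a).
set b1 := pos_part b; set b2 := pos_part (- b).
rewrite (@span_scaleE _
  ((a1%:num * b1%:num)%:nng%:num + (a2%:num * b2%:num)%:nng%:num)%:nng
  ((a1%:num * b2%:num)%:nng%:num + (a2%:num * b1%:num)%:nng%:num)%:nng).
  rewrite /pair_scale /= !cone_scaleDl !cone_scaleDr !cone_scaleA.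
  by congr (span_pi (_, _)); rewrite [X in _ + X]addrC addrACA.
by rewrite {1}(pos_partE a) {1}(pos_partE b) -/a1 -/a2 -/b1 -/b2 /=; ring.
Qed.

Lemma span_scale1 : left_id 1 span_scale.
Proof.
elim/spanW=> p; rewrite (@span_scaleE _ 1%:nng 0%:nng) /=; last by rewrite subr0.
by rewrite /pair_scale !cone_scale1 !cone_scale0 !addr0 -surjective_pairing.
Qed.

Lemma span_scaleDr : right_distributive span_scale +%R.
Proof.
move=> l; elim/spanW=> p; elim/spanW=> q.
rewrite [span_pi p + _]span_addE !(span_scaleE _ (pos_partE l)).
rewrite [RHS]span_addE /pair_scale /= !cone_scaleDr.
by congr (span_pi (_, _)); rewrite addrACA.
Qed.

Lemma span_scaleDl x : {morph span_scale^~ x : a b / a + b}.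
Proof.
move=> a b /=; elim/spanW: x => p.
rewrite (@span_scaleE _ ((pos_part a)%:num + (pos_part b)%:num)%:nng
  ((pos_part (- a))%:num + (pos_part (- b))%:num)%:nng).
  rewrite (span_scaleE _ (pos_partE a)) (span_scaleE _ (pos_partE b)).
  rewrite [RHS]span_addE /pair_scale /= !cone_scaleDl.
  by congr (span_pi (_, _)); rewrite addrACA.
rewrite {1}(pos_partE a) {1}(pos_partE b) /=; ring.
Qed.

HB.instance Definition _ := GRing.Zmodule_isLmodule.Build R cone_span
  span_scaleA span_scale1 span_scaleDr span_scaleDl.

Lemma span_embed_inj : injective span_embed.
Proof.
by move=> v w /eqP; rewrite eqmodE => /eqP /=; rewrite !addr0.
Qed.

Lemma span_embedD : {morph span_embed : v w / v + w}.
Proof. by move=> v w; rewrite [RHS]span_addE /= addr0. Qed.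

Lemma span_embedZ (l : {nonneg R}) v :
  span_embed (l *^ v) = l%:num *: span_embed v.
Proof.
rewrite [RHS](@span_scaleE _ l 0%:nng) ?subr0 //.
by rewrite /pair_scale /= !cone_scaler0 cone_scale0 !addr0.
Qed.

Lemma span_pi_embed p : span_pi p = span_embed p.1 - span_embed p.2.
Proof.
by rewrite [- _]span_oppE [RHS]span_addE /= addr0 add0r -surjective_pairing.
Qed.
End Span.

Arguments cone_span {R} F.

Definition symmetric_bilinear (R : realType) (V : lmodType R)
    (B : V -> V -> R) :=
  (forall x y, B x y = B y x) /\ (forall y, scalar (B^~ y)).

(* <v1 - v2, w1 - w2> is expanded by bilinearity. By induced_innerP and
   induced_inner_unique below, this is the unique symmetric bilinear form on
   cone_span F that extends cone_inner N, when N is a finite-valued positively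
   polarizable hyperbolic norm. *)
Definition induced_inner (R : realType) (F : linearConeType R)
    (N : F -> \bar R) (x y : cone_span F) : R :=
  let: (v1, v2) := repr x in let: (w1, w2) := repr y in
  cone_inner N v1 w1 - cone_inner N v1 w2
  - cone_inner N v2 w1 + cone_inner N v2 w2.

Section InducedInner.
Variables (R : realType) (F : linearConeType R) (N : F -> \bar R).
Hypothesis N_hyp : hyperbolic_norm N.
Hypothesis N_pol : positively_polarizable N.
Hypothesis N_fin : forall v, (N v < +oo)%E.
Implicit Types (u v w : F).

Let n v := fine (N v).
Let s v := n v ^+ 2.
Let b := cone_inner N.

Let nE v : N v = (n v)%:E.
Proof.
case: N_hyp => N0 _ _; rewrite /n; move: (N0 v) (N_fin v).
by case: (N v).
Qed.

Let n_ge0 v : 0 <= n v.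
Proof. by case: N_hyp => N0 _ _; rewrite -lee_fin -nE. Qed.

Let nD v w : n v + n w <= n (v + w).
Proof.
by case: N_hyp => _ ND _; move: (ND v w); rewrite !nE -EFinD lee_fin.
Qed.

Let nZ l v : n (l *^ v) = l%:num * n v.
Proof. by case: N_hyp => _ _ NZ; have := NZ l v; rewrite !nE -EFinM => -[]. Qed.

Let cone_scale2 v : 2%:nng *^ v = v + v.
Proof.
rewrite -{2 3}[v]cone_scale1 -cone_scaleDl.
by congr (_ *^ _); apply/val_inj.
Qed.

Let s_pol v w : s (v + w + w) + s v = 2 * s (v + w) + 2 * s w.
Proof.
have := N_pol v w; rewrite cone_scale2 addrA !nE -!EFin_expe -!EFinM -!EFinD.
by case.
Qed.

Let s0 : s 0 = 0.
Proof.
by rewrite /s -(cone_scale0 (0 : F)) nZ /= mul0r expr0n.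
Qed.

Let s_cube u v w : s (u + v + w) = s (u + v) + s (u + w) + s (v + w)
  - s u - s v - s w.
Proof.
pose a i j k := s (u *+ i + v *+ j + w *+ k).
have a_pol i j k i' j' k' : a (i + i' + i')%N (j + j' + j')%N (k + k' + k')%N
    + a i j k = 2 * a (i + i')%N (j + j')%N (k + k')%N + 2 * a i' j' k'.
  have E x y z x' y' z' : u *+ (x + x') + v *+ (y + y') + w *+ (z + z') =
     u *+ x + v *+ y + w *+ z + (u *+ x' + v *+ y' + w *+ z').
    by rewrite !mulrnDr [RHS]addrACA; congr (_ + _); rewrite addrACA.
  by rewrite /a !E s_pol.
have -> : s (u + v + w) = a 1 1 1 by [].
have -> : s (u + v) = a 1 1 0 by rewrite /a mulr0n addr0.
have -> : s (u + w) = a 1 0 1 by rewrite /a mulr0n addr0.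
have -> : s (v + w) = a 0 1 1 by rewrite /a mulr0n add0r.
have -> : s u = a 1 0 0 by rewrite /a !mulr0n !addr0.
have -> : s v = a 0 1 0 by rewrite /a !mulr0n addr0 add0r.
have -> : s w = a 0 0 1 by rewrite /a !mulr0n !add0r.
have a0 : a 0 0 0 = 0 by rewrite /a !mulr0n !add0r s0.
have := a_pol 0 0 1 1 1 0; have := a_pol 0 0 0 1 1 0.
have := a_pol 0 2 1 1 0 0; have := a_pol 0 2 0 1 0 0.
have := a_pol 0 0 1 0 1 0; have := a_pol 0 0 0 0 1 0.
have := a_pol 1 0 1 0 1 0; have := a_pol 1 0 0 0 1 0.
rewrite !addn0 !add0n !addn1 a0; lra.
Qed.

Let bE v w : b v w = 2^-1 * (s (v + w) - s v - s w).
Proof. by []. Qed.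

Let bC v w : b v w = b w v.
Proof. by rewrite !bE [v + w]addrC; lra. Qed.

Let bD u v w : b (u + v) w = b u w + b v w.
Proof. by rewrite !bE s_cube; lra. Qed.

Let b_ge0 v w : 0 <= b v w.
Proof.
rewrite bE /s; have := nD v w; have := n_ge0 v; have := n_ge0 w.
nra.
Qed.

Let b0 w : b 0 w = 0.
Proof. by rewrite bE add0r s0; lra. Qed.

Let bMn v w k : b (v *+ k) w = k%:R * b v w.
Proof.
elim: k => [|k IH]; first by rewrite mulr0n b0 mul0r.
by rewrite mulrSr bD IH -natr1; ring.
Qed.

Let cone_scaleMn (l m : {nonneg R}) v k :
  m%:num = l%:num *+ k -> m *^ v = (l *^ v) *+ k.
Proof.
elim: k m => [|k IH] m mE.
  by rewrite mulr0n -(cone_scale0 v); congr (_ *^ _); apply/val_inj.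
have k0 : 0 <= l%:num *+ k by rewrite mulrn_wge0.
rewrite mulrSr -(IH (NngNum k0)) // -cone_scaleDl.
by congr (_ *^ _); apply/val_inj; rewrite /= mE mulrSr.
Qed.

Let b_mono (l m : {nonneg R}) v w : l%:num <= m%:num ->
  b (l *^ v) w <= b (m *^ v) w.
Proof.
move=> lm; have d0 : 0 <= m%:num - l%:num by rewrite subr_ge0.
have -> : m = (l%:num + (NngNum d0)%:num)%:nng.
  by apply/val_inj; rewrite /= addrC subrK.
by rewrite cone_scaleDl bD lerDl.
Qed.

Let bZ (l : {nonneg R}) v w : b (l *^ v) w = l%:num * b v w.
Proof.
have bound (k : nat) : k%:R * `|b (l *^ v) w - l%:num * b v w| <= b v w.
  have l0 : 0 <= l%:num *+ k by rewrite mulrn_wge0.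
  pose j := Num.truncn (l%:num *+ k).
  have /andP[j1 j2] := truncn_itv l0; rewrite -/j in j1 j2.
  have i0 (i : nat) : 0 <= i%:R :> R by [].
  have nk (i : nat) : b (NngNum (i0 i) *^ v) w = i%:R * b v w.
    by rewrite (@cone_scaleMn 1%:nng _ _ i) // cone_scale1 bMn.
  have lk : b (NngNum l0 *^ v) w = k%:R * b (l *^ v) w.
    by rewrite (@cone_scaleMn l _ _ k) // bMn.
  have h1 : j%:R * b v w <= k%:R * b (l *^ v) w.
    by rewrite -nk -lk; apply: b_mono.
  have h2 : k%:R * b (l *^ v) w <= j.+1%:R * b v w.
    by rewrite -nk -lk; apply: b_mono; apply: ltW.
  have h3 : j%:R * b v w <= k%:R * (l%:num * b v w).
    by rewrite mulrA; apply: ler_wpM2r => //; rewrite mulrC mulr_natr.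
  have h4 : k%:R * (l%:num * b v w) <= j.+1%:R * b v w.
    rewrite mulrA; apply: ler_wpM2r => //; rewrite mulrC mulr_natr.
    exact: ltW.
  have kE : k%:R = `|k%:R| :> R by rewrite normr_nat.
  rewrite {1}kE -normrM mulrBr ler_norml.
  move: h2 h4; rewrite -natr1 mulrDl mul1r => h2 h4.
  apply/andP; split; lra.
apply/eqP; rewrite -subr_eq0 -normr_eq0; apply/negP => /negP ne0.
have c_gt0 : 0 < `|b (l *^ v) w - l%:num * b v w| by rewrite lt0r ne0 /=.
have := bound (Num.truncn (b v w / `|b (l *^ v) w - l%:num * b v w|)).+1.
rewrite leNgt -ltr_pdivrMr // => /negP; apply.
by apply: truncnS_gt.
Qed.

Let b4 p q := b p.1 q.1 - b p.1 q.2 - b p.2 q.1 + b p.2 q.2.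

Let b4C p q : b4 p q = b4 q p.
Proof. by rewrite /b4 !(bC q.1) !(bC q.2); lra. Qed.

Let b4_rel p p' q : p.1 + p'.2 = p'.1 + p.2 -> b4 p q = b4 p' q.
Proof.
move=> pp'; have E w : b p.1 w + b p'.2 w = b p'.1 w + b p.2 w.
  by rewrite -!bD pp'.
by rewrite /b4; have := E q.1; have := E q.2; lra.
Qed.

Let induced_piE p q : induced_inner N (span_pi p) (span_pi q) = b4 p q.
Proof.
transitivity (b4 (repr (span_pi p)) (repr (span_pi q))).
  by rewrite /induced_inner; case: (repr _) => ? ?; case: (repr _).
rewrite (b4_rel _ (span_reprP p)) b4C (b4_rel _ (span_reprP q)).
exact: b4C.
Qed.

Lemma induced_innerP : symmetric_bilinear (induced_inner N) /\
  forall v w, induced_inner N (span_embed v) (span_embed w) = cone_inner N v w.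
Proof.
split; last first.
  by move=> v w; rewrite induced_piE /b4 /= [b v 0]bC [b 0 0]b0 !b0 /b; lra.
split; first by elim/spanW => p; elim/spanW => q; rewrite !induced_piE b4C.
elim/spanW=> r l; elim/spanW=> p; elim/spanW=> q /=.
rewrite [l *: _](span_scaleE _ (pos_partE l)) [_ + span_pi q]span_addE.
rewrite !induced_piE /b4 /= !bD !bZ [in RHS](pos_partE l); ring.
Qed.

Lemma induced_inner_unique (B : cone_span F -> cone_span F -> R) :
    symmetric_bilinear B ->
    (forall v w, B (span_embed v) (span_embed w) = cone_inner N v w) ->
  forall x y, B x y = induced_inner N x y.
Proof.
move=> [BC Blin] BE; elim/spanW => p; elim/spanW => q; rewrite induced_piE.
have BB x y z : B (x - y) z = B x z - B y z.
  by rewrite addrC -scaleN1r Blin mulN1r addrC.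
rewrite !span_pi_embed BB ![B _ (_ - _)]BC !BB ![B _ (span_embed p.1)]BC.
by rewrite ![B _ (span_embed p.2)]BC !BE /b4 /b; lra.
Qed.

End InducedInner.

(* Main.v *)
Require Import Defs.
From mathcomp Require Import all_boot all_order all_algebra.
From mathcomp Require Import reals constructive_ereal interval_inference.
From mathcomp Require Import lra.

Set Implicit Arguments.
Unset Strict Implicit.
Unset Printing Implicit Defensive.

Import Order.TTheory GRing.Theory Num.Theory.
Local Open Scope ring_scope.

(** Let the radical of the inner product contain [p - q], where [p] and [q]
lie in the cone, so that [p] and [q] pair equally with every vector.  Pairing
them with [p] and with [q] shows that [<p, p> = <p, q> = <q, q>], which is the
equality case of the reverse triangle inequality [|p| + |q| <= |p + q|]
([cone_norm_add_eq]).  Strict hyperbolicity then puts [p] and [q] on a common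
ray, say [p = l q].

It remains to see that [l = 1] or [q = 0].  Let [t] be a vector with
[|t| > 0].  Pairing with [t] gives [l <q, t> = <q, t>], hence [l = 1] unless
[<q, t> = 0].  But only [0] is orthogonal to [t] ([cone_inner_eq0]):
orthogonality makes [|q + t|^2] equal to [|q|^2 + |t|^2], which hyperbolicity
allows only when [|q| = 0]; then [|q + t| = |t| = |q| + |t|], and strict
hyperbolicity puts the null vector [q] on the ray of [t], where [0] is the
only null vector. *)

Section FiniteNorm.
Variables (R : realType) (F : linearConeType R) (N : F -> \bar R).
Hypothesis N_hyp : hyperbolic_norm N.
Hypothesis N_fin : forall v, (N v < +oo)%E.
Implicit Types (u v w t : F) (l : {nonneg R}).

Lemma cone_normE v : N v = (fine (N v))%:E.
Proof.
by case: N_hyp => N0 _ _; move: (N0 v) (N_fin v); case: (N v).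
Qed.

Lemma cone_norm_ge0 v : 0 <= fine (N v).
Proof. by case: N_hyp => N0 _ _; apply: fine_ge0. Qed.

Lemma cone_norm_superadditive v w :
  fine (N v) + fine (N w) <= fine (N (v + w)).
Proof.
by case: N_hyp => _ ND _; rewrite -lee_fin EFinD -!cone_normE.
Qed.

Lemma cone_normZ l v : fine (N (l *^ v)) = l%:num * fine (N v).
Proof. by case: N_hyp => _ _ NZ; rewrite NZ (cone_normE v) -EFinM. Qed.

Lemma cone_norm_addE v w :
  fine (N (v + w)) ^+ 2
    = fine (N v) ^+ 2 + fine (N w) ^+ 2 + 2 * cone_inner N v w.
Proof. by rewrite /cone_inner; lra. Qed.

(** The hypothesis is the equality case of the reverse Cauchy-Schwarz
inequality [|v| |w| <= <v, w>]; then [|v + w|^2 = (|v| + |w|)^2]. *)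
Lemma cone_norm_add_eq v w :
  cone_inner N v w = fine (N v) * fine (N w) -> N (v + w) = (N v + N w)%E.
Proof.
move=> vw; rewrite (cone_normE v) (cone_normE w) cone_normE -EFinD; congr _%:E.
apply/eqP; rewrite -(@eqrXn2 _ 2) ?addr_ge0 ?cone_norm_ge0 //; apply/eqP.
by rewrite cone_norm_addE vw; lra.
Qed.

(** The reverse Cauchy-Schwarz inequality makes [v] null, so that
[|v + t| = |v| + |t|] and [v] is on the ray of [t], which carries no null
vector except [0]. *)
Lemma cone_inner_eq0 v t : strictly_hyperbolic N ->
  (0 < N t)%E -> cone_inner N v t = 0 -> v = 0.
Proof.
move=> N_strict; rewrite cone_normE lte_fin => t_gt0 vt.
have v_null : fine (N v) = 0.
  have := cone_norm_addE v t; rewrite vt.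
  have := cone_norm_superadditive v t; have := cone_norm_ge0 v; nra.
have [|l [vlt|tlv]] := N_strict v t.
- by apply: cone_norm_add_eq; rewrite vt v_null mul0r.
- move: v_null; rewrite vlt cone_normZ => /eqP.
  rewrite mulf_eq0 (gt_eqF t_gt0) orbF => /eqP l0.
  by rewrite -(cone_scale0 t); congr (_ *^ _); apply/val_inj.
- by move: t_gt0; rewrite tlv cone_normZ v_null mulr0 ltxx.
Qed.

End FiniteNorm.

Section Polarizable.
Variables (R : realType) (F : linearConeType R) (N : F -> \bar R).
Hypothesis N_hyp : hyperbolic_norm N.
Hypothesis N_pol : positively_polarizable N.
Hypothesis N_fin : forall v, (N v < +oo)%E.
Implicit Types (u v w t : F) (l : {nonneg R}).

Lemma cone_innerZl l v w :
  cone_inner N (l *^ v) w = l%:num * cone_inner N v w.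
Proof.
have [[_ lin] ext] := induced_innerP N_hyp N_pol N_fin.
rewrite -!ext span_embedZ -[_ *: _]addr0 lin.
(* The bilinear form vanishes at 0, being linear on the left. *)
have := lin (span_embed w) (-1) 0 0; rewrite scaler0 addr0; lra.
Qed.

Lemma cone_inner_diag v : cone_inner N v v = fine (N v) ^+ 2.
Proof.
have : fine (N (v + v)) = 2 * fine (N v).
  by rewrite -{1 2}[v]cone_scale1 -cone_scaleDl cone_normZ.
by rewrite /cone_inner => -> /=; lra.
Qed.

Lemma induced_inner_span_pi p w :
  induced_inner N (span_pi p) (span_embed w)
    = cone_inner N p.1 w - cone_inner N p.2 w.
Proof.
have [[_ lin] ext] := induced_innerP N_hyp N_pol N_fin.
by rewrite span_pi_embed addrC -scaleN1r lin !ext; lra.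
Qed.

(** On the ray of [w], pairing with [t] determines the scalar, because [t] is
orthogonal to no nonzero vector of the cone. *)
Lemma cone_ray_inner_inj l v w t : strictly_hyperbolic N -> (0 < N t)%E ->
  v = l *^ w -> cone_inner N v t = cone_inner N w t -> v = w.
Proof.
move=> N_strict t_gt0 ->; rewrite cone_innerZl.
have [/(cone_inner_eq0 N_hyp N_fin N_strict t_gt0) -> _ | wt_neq0 lwt] :=
  eqVneq (cone_inner N w t) 0; first exact: cone_scaler0.
rewrite -[RHS]cone_scale1; congr (_ *^ _); apply/val_inj/(mulIf wt_neq0).
by rewrite /= lwt mul1r.
Qed.

End Polarizable.

Theorem theorem3p6 (R : realType) (F : linearConeType R) (N : F -> \bar R)
    (F_proper : proper_cone F)
    (N_hyp : hyperbolic_norm N)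
    (N_pol : positively_polarizable N)
    (N_fin : forall v : F, (N v < +oo)%E)
    (N_nontriv : exists t : F, (0 < N t)%E)
    (N_strict : strictly_hyperbolic N) :
  forall v : cone_span F, (forall u : cone_span F, induced_inner N v u = 0) -> v = 0.
Proof.
elim/spanW => -[p q] pq_null; have [t t_gt0] := N_nontriv.
have pqE w : cone_inner N p w = cone_inner N q w.
  have := pq_null (span_embed w).
  by rewrite induced_inner_span_pi // => /eqP; rewrite subr_eq0 => /eqP.
suff -> : p = q by rewrite span_pi_embed subrr.
have pp := cone_inner_diag N_hyp N_fin p.
have qq := cone_inner_diag N_hyp N_fin q.
have qpC : cone_inner N q p = cone_inner N p q.
  by rewrite /cone_inner [q + p]addrC addrAC.
have norm_eq : fine (N p) = fine (N q).
  apply/eqP; rewrite -(@eqrXn2 _ 2) ?cone_norm_ge0 //.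
  by rewrite -pp -qq pqE qpC pqE.
have [|l [plq|qlp]] := N_strict p q.
- by apply: cone_norm_add_eq => //; rewrite norm_eq pqE qq expr2.
- exact: (cone_ray_inner_inj N_hyp N_pol N_fin N_strict t_gt0 plq).
- exact/esym/(cone_ray_inner_inj N_hyp N_pol N_fin N_strict t_gt0 qlp).
Qed.
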